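(* Let $d,r\in\mathbb{N}$, $\epsilon\in(0,1)$, let $\mathcal{H}$ be a non-redundant $r$-set of rooted digraphs, and for $n\in\mathbb{N}$ let $P^*_{\mathcal{H}_n}$ be the set of $n$-vertex digraphs of the $F(d)$-model that are $\mathcal{H}$-free as induced subgraphs. Let $P=\bigcup_nP_n$ be a digraph property in the $F(d)$-model ($P_n$ its $n$-vertex members) such that for every $n$: (a) $P_n\subseteq P^*_{\mathcal{H}_n}$, and (b) $P^*_{\mathcal{H}_n}$ is $\epsilon/2$-close to $P_n$. Then $P$ is $1$-sided error $\epsilon$-strongly-testable in the $F(d)$-model.
   Context: The $F(d)$-model consists of all digraphs (no multiple edges) with every out-degree at most $d$. A query to an $n$-vertex digraph specifies a vertex $v$ and returns the set $\Gamma^+(v)$ of out-neighbours of $v$. A digraph property is a set of digraphs closed under isomorphism. $G$ is $\mathcal{H}$-free as induced subgraphs if no induced subgraph of $G$ is isomorphic to a member of $\mathcal{H}$; $\mathcal{H}$ is non-redundant if no $H\in\mathcal{H}$ contains as an induced subgraph a member of $\mathcal{H}$ other than itself. For $n$-vertex digraphs $G,G'$ of the model, $\mathrm{dist}(G,G')$ is the number of edge deletions/insertions turning $G$ into $G'$; $G$ is $\epsilon$-far from $G'$ if $\mathrm{dist}>\epsilon dn$, otherwise $\epsilon$-close; $G$ is $\epsilon$-close to a set if $\epsilon$-close to some member; two sets are $\epsilon$-close if every graph in each is $\epsilon$-close to the other. A $1$-sided error $\epsilon$-test for $P$ accepts every $n$-vertex digraph in $P$ with probability $1$ and rejects every $n$-vertex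 digraph $\epsilon$-far from $P_n$ with probability at least $1/2$. $P$ is $1$-sided error $\epsilon$-strongly-testable if it has such a test whose number of queries is bounded by a quantity depending only on $\epsilon$. An $r$-set is a set of digraphs each with at most $r$ vertices. A digraph is rooted if each component (subdigraph induced by a connected component of the underlying undirected graph) has a vertex from which all its vertices are reachable by directed paths within the component. *)

(* Defs.v *)
From HB Require Import structures.
From mathcomp Require Import all_boot all_order all_algebra.
From mathcomp Require Import reals.

Set Implicit Arguments.
Unset Strict Implicit.
Unset Printing Implicit Defensive.

Import Order.TTheory GRing.Theory Num.Theory.

Local Open Scope ring_scope.

(** * Digraphs *)

(* A digraph is its set of edges (u, v), read u -> v; this rules out multiple
   edges but neither antiparallel pairs nor loops.  The loop-free model is the
   special case in which the one-vertex loop is put among the forbidden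
   induced subgraphs. *)
Notation digraph T := {set T * T}.

Definition edge (T : finType) (G : digraph T) : rel T :=
  [rel u v | (u, v) \in G].

Definition out_nbhd (T : finType) (G : digraph T) (v : T) : {set T} :=
  [set u | edge G v u].

Definition isomorphic (T U : finType) (G : digraph T) (F : digraph U) : Prop :=
  exists f : T -> U, bijective f /\ forall u v, edge F (f u) (f v) = edge G u v.

Definition induced (T : finType) (G : digraph T) (S : {set T}) :
    digraph {x : T | x \in S} :=
  [set e | edge G (val e.1) (val e.2)].

Definition has_induced (T U : finType) (G : digraph T) (F : digraph U) : Prop :=
  exists S : {set T}, isomorphic (induced G S) F.

Definition underlying (T : finType) (G : digraph T) : rel T :=
  [rel u v | edge G u v || edge G v u].

Definition component (T : finType) (G : digraph T) (x : T) : {set T} :=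
  [set y | connect (underlying G) x y].

(* [connect e] is the reflexive-transitive closure of [e]. *)
Definition rooted (T : finType) (G : digraph T) : Prop :=
  forall x : T,
  exists root : {y : T | y \in component G x},
  forall y : {y : T | y \in component G x},
    connect (edge (induced G (component G x))) root y.

(** * Sets of digraphs *)

(* The members with n vertices are given on the vertex set 'I_n. *)
Definition digraph_set := forall n : nat, digraph 'I_n -> Prop.

(* Members of [H] are compared up to isomorphism, so it is irrelevant whether
   [H] lists one or several labelled copies of a digraph. *)
Definition non_redundant (H : digraph_set) : Prop :=
  forall (m k : nat) (F : digraph 'I_m) (F' : digraph 'I_k),
    H m F -> H k F' -> has_induced F F' -> isomorphic F F'.

Definition is_r_set (r : nat) (H : digraph_set) : Prop :=
  forall (m : nat) (F : digraph 'I_m), H m F -> (m <= r)%N.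

Definition all_rooted (H : digraph_set) : Prop :=
  forall (m : nat) (F : digraph 'I_m), H m F -> rooted F.

(** * The bounded out-degree model *)

Definition in_model (d n : nat) (G : digraph 'I_n) : Prop :=
  forall v, (#|out_nbhd G v| <= d)%N.

Definition digraph_property (d : nat) (P : digraph_set) : Prop :=
  (forall n (G : digraph 'I_n), P n G -> in_model d G) /\
  (forall n (G G' : digraph 'I_n), isomorphic G G' -> P n G -> P n G').

Definition induced_free (d : nat) (H : digraph_set) : digraph_set :=
  fun n G => in_model d G /\
    forall (m : nat) (F : digraph 'I_m), H m F -> ~ has_induced G F.
Arguments induced_free : clear implicits.

(** * Distance *)

Definition dist (n : nat) (G G' : digraph 'I_n) : nat :=
  (#|G :\: G'| + #|G' :\: G|)%N.

Definition eps_close (R : realType) (d : nat) (eps : R) (n : nat)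
    (G G' : digraph 'I_n) : bool :=
  (dist G G')%:R <= eps * d%:R * n%:R.

Definition close_to_set (R : realType) (d : nat) (eps : R) (n : nat)
    (G : digraph 'I_n) (Q : digraph 'I_n -> Prop) : Prop :=
  exists G', Q G' /\ eps_close d eps G G'.

Definition sets_close (R : realType) (d : nat) (eps : R) (n : nat)
    (Q Q' : digraph 'I_n -> Prop) : Prop :=
  (forall G, Q G -> close_to_set d eps G Q') /\
  (forall G', Q' G' -> close_to_set d eps G' Q).

(** * Testers *)

(* A deterministic adaptive query algorithm on vertex set 'I_n. *)
Inductive query_alg (n : nat) : Type :=
| Answer of bool
| Query of 'I_n & ({set 'I_n} -> query_alg n).

Fixpoint accepts (n : nat) (t : query_alg n) (G : digraph 'I_n) : bool :=
  match t with
  | Answer b => b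
  | Query v k => accepts (k (out_nbhd G v)) G
  end.

Fixpoint queries (n : nat) (t : query_alg n) (G : digraph 'I_n) : nat :=
  match t with
  | Answer _ => 0
  | Query v k => (queries (k (out_nbhd G v)) G).+1
  end.

(* A randomised algorithm is a probability distribution over deterministic
   ones.  For a fixed n and a bounded number of queries there are only finitely
   many behaviours, so a finite sample space is no restriction. *)
Record rand_alg (R : realType) (n : nat) := RandAlg {
  seed : finType;
  prob : seed -> R;
  alg : seed -> query_alg n;
  prob_ge0 : forall s, 0 <= prob s;
  prob_sum1 : \sum_s prob s = 1
}.

Definition accept_prob (R : realType) (n : nat) (A : rand_alg R n)
    (G : digraph 'I_n) : R :=
  \sum_(s : seed A | accepts (alg s) G) prob s.

Definition reject_prob (R : realType) (n : nat) (A : rand_alg R n)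
    (G : digraph 'I_n) : R :=
  \sum_(s : seed A | ~~ accepts (alg s) G) prob s.

Definition one_sided_test (R : realType) (d : nat) (eps : R) (P : digraph_set)
    (A : forall n, rand_alg R n) : Prop :=
  forall (n : nat) (G : digraph 'I_n), in_model d G ->
    (P n G -> accept_prob (A n) G = 1) /\
    (~ close_to_set d eps G (P n) -> 2^-1 <= reject_prob (A n) G).

(* [q] is chosen before the number n of vertices. *)
Definition one_sided_strongly_testable (R : realType) (d : nat) (eps : R)
    (P : digraph_set) : Prop :=
  exists (q : nat) (A : forall n, rand_alg R n),
    one_sided_test d eps P A /\
    forall (n : nat) (G : digraph 'I_n), in_model d G ->
      forall s : seed (A n), (queries (alg s) G <= q)%N.

(* Main.v *)
Require Import Defs.
From mathcomp Require Import all_boot all_order all_algebra.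
From mathcomp Require Import reals.
From mathcomp Require Import boolp zify lra.

(* The test samples a few vertices, explores their out-neighbourhoods to depth
   [r + 2], and rejects iff what it has seen contains a forbidden induced
   subgraph.

   If G is far from P then it is eps/2-far from being H-free.  Call a vertex
   heavy, middling or low according to the number of vertices reaching it in
   few steps; pigeonholing over a sequence of scales makes the middling vertices
   together reachable from few vertices, while low ones are negligible even
   compared with the (bounded) number of patterns in which a component of a
   forbidden graph can be attached to the heavy vertices (the hubs).  Let X
   consist of the middling vertices and of the roots of components whose pattern
   is seen by few vertices; few vertices point into X.  If X met every forbidden
   copy, then detaching X and turning its vertices into copies of a popular
   vertex would give an H-free graph close to G.  So some forbidden copy has only
   frequent patterns.  Components are rooted, so a random vertex sees a copy of a
   prescribed component with constant probability, and since distinct components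
   can only interfere through low vertices, independent samples yield compatible
   copies, which combine into a forbidden copy. *)

Set Implicit Arguments.
Unset Strict Implicit.
Unset Printing Implicit Defensive.

(** * Induced copies as embeddings *)

Definition embedding (U T : finType) (F : digraph U) (G : digraph T)
    (f : U -> T) : Prop :=
  injective f /\ forall x y, edge G (f x) (f y) = edge F x y.

Lemma has_inducedP (T U : finType) (G : digraph T) (F : digraph U) :
  has_induced G F <-> exists f : U -> T, embedding F G f.
Proof.
split=> [[S [f [[g fK gK] fE]]] | [f [f_inj fE]]].
  exists (fun x => val (g x)); split=> [x y /val_inj /(can_inj gK) //|x y].
  by rewrite -{2}[x]gK -{2}[y]gK fE /edge /= inE.
exists [set f x | x : U].
have f_mem x : f x \in [set f x | x : U] by apply: imset_f.
have g_ex (y : {y | y \in [set f x | x : U]}) : {x | f x = val y}.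
  by apply: cid; case/imsetP: (valP y) => x _ ->; exists x.
exists (fun y => sval (g_ex y)); split.
  exists (fun x => exist _ (f x) (f_mem x)) => [y|x].
    by apply: val_inj; exact: (svalP (g_ex y)).
  by apply: f_inj; rewrite (svalP (g_ex _)).
by move=> u v; rewrite -fE !(svalP (g_ex _)) /edge /= inE.
Qed.

(** * Counting, and balls of bounded depth *)

Lemma card_bigcup_le (I T : finType) (P : pred I) (A : I -> {set T}) :
  #|\bigcup_(i | P i) A i| <= \sum_(i | P i) #|A i|.
Proof.
elim/big_ind2: _ => [|m B n C Bm Cn|//]; first by rewrite cards0.
by apply: leq_trans (leq_card_setU _ _) _; apply: leq_add.
Qed.

Lemma card_bigcup_le_mul (I T : finType) (P : pred I) (A : I -> {set T}) c :
  (forall i, P i -> #|A i| <= c) -> #|\bigcup_(i | P i) A i| <= #|P| * c.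
Proof.
move=> Ac; apply: leq_trans (card_bigcup_le _ _) _.
by rewrite -sum_nat_const; apply: leq_sum.
Qed.

(* [ball G k v] is the set of vertices reached from [v] in fewer than [k] steps,
   so that it can be explored, with all out-edges, at depth [k]. *)
Fixpoint ball (T : finType) (G : digraph T) (k : nat) (v : T) : {set T} :=
  if k is k'.+1 then v |: \bigcup_(u in out_nbhd G v) ball G k' u else set0.

Fixpoint ball_size (d k : nat) : nat :=
  if k is k'.+1 then (d * ball_size d k').+1 else 0.

Section Balls.
Variables (T : finType) (G : digraph T).

Lemma ball_self k v : v \in ball G k.+1 v.
Proof. by rewrite /= setU11. Qed.

Lemma ball_step k u v w : edge G u v -> w \in ball G k v -> w \in ball G k.+1 u.
Proof.
move=> uv wv; rewrite /= inE; apply/orP; right.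
by apply/bigcupP; exists v; rewrite ?inE.
Qed.

Lemma ballSP k u w :
  reflect (w = u \/ exists2 x, edge G u x & w \in ball G k x)
          (w \in ball G k.+1 u).
Proof.
apply: (iffP idP) => [|[->|[x ux wx]]].
- rewrite in_setU1 => /orP[/eqP->|/bigcupP[x]]; [by left | right].
  by rewrite inE in p; exists x.
- exact: ball_self.
- exact: ball_step wx.
Qed.

Lemma ball_trans k u v w : v \in ball G k u -> edge G v w -> w \in ball G k.+1 u.
Proof.
elim: k u => [|k IHk] u; first by rewrite inE.
case/ballSP=> [-> vw|[x ux vx] vw]; last exact: ball_step ux (IHk _ vx vw).
by apply: ball_step vw _; apply: ball_self.
Qed.

Lemma subset_ball k l u : k <= l -> ball G k u \subset ball G l u.
Proof.
elim: k l u => [|k IHk] [|l] u // kl; first exact: sub0set.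
apply/subsetP => w /ballSP[->|[x ux wx]]; first exact: ball_self.
by apply: ball_step ux (subsetP (IHk l x kl) w wx).
Qed.

Lemma card_ball d k v :
  (forall v, #|out_nbhd G v| <= d) -> #|ball G k v| <= ball_size d k.
Proof.
move=> Gd; elim: k v => [|k IHk] v /=; first by rewrite cards0.
rewrite cardsU1 -add1n leq_add ?leq_b1 //.
apply: leq_trans (card_bigcup_le_mul (fun u _ => IHk u)) _.
by rewrite leq_mul2r (leq_trans _ (Gd v)) ?orbT.
Qed.

End Balls.

(** A path in [F] shortens to one without repeated vertices, hence with fewer than [#|U|] edges.
    Only edges leaving [A] must be preserved, since a local copy is controlled on one component
    only. *)
Lemma ball_path (U T : finType) (F : digraph U) (G : digraph T) (f : U -> T)
    (A : {set U}) x y :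
  {in A, forall u v, edge F u v -> v \in A /\ edge G (f u) (f v)} ->
  x \in A -> connect (edge F) x y -> f y \in ball G #|U| (f x).
Proof.
move=> fE xA /connectP[p Fp ->]; case/shortenP: Fp => q Fq /card_uniqP q_size _.
have {q_size}: size q < #|U| by rewrite -[_.+1]q_size max_card.
move=> q_lt; apply: subsetP (subset_ball _ _ q_lt) _ _.
elim: q x xA Fq {q_lt} => [|z q IHq] x xA; first by rewrite ball_self.
move=> /= /andP[xz zq]; have [zA Gxz] := fE x xA z xz.
exact: ball_step Gxz (IHq z zA zq).
Qed.

(** * Exploration by queries *)

(* The knowledge gathered so far is the set of queried vertices together with
   the set of edges leaving them. *)
Notation knowledge n := ({set 'I_n} * digraph 'I_n)%type.

(** The continuation [c] is the rest of the algorithm, so that explorations are chained by [foldr].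
    Vertices met again are queried again, which affects only the query count. *)
Fixpoint explore n k (v : 'I_n) (c : knowledge n -> query_alg n)
    (K : knowledge n) : query_alg n :=
  if k is k'.+1 then
    Query v (fun N => foldr (explore k') c (enum N)
      (v |: K.1, K.2 :|: [set e | (e.1 == v) && (e.2 \in N)]))
  else c K.

Definition revealed n (G : digraph 'I_n) (S : {set 'I_n}) : knowledge n :=
  (S, [set e in G | e.1 \in S]).

Section Explore.
Variables (n : nat) (G : digraph 'I_n).

Lemma revealedU1 v S :
  (v |: S, (revealed G S).2 :|: [set e | (e.1 == v) && (e.2 \in out_nbhd G v)])
  = revealed G (v |: S).
Proof.
congr pair; apply/setP => [[x y]]; rewrite !inE /edge /=.
by case: (x =P v) => [->|_] /=; [case: (_ \in G); rewrite ?orbT | rewrite orbF].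
Qed.

Lemma exploreP k (v : 'I_n) c S :
  accepts (explore k v c (revealed G S)) G =
  accepts (c (revealed G (S :|: ball G k v))) G.
Proof.
elim: k v c S => [|k IHk] v c S /=; first by rewrite setU0.
rewrite revealedU1 -big_enum setUA [S :|: [set v]]setUC.
elim: (enum _) (v |: S) => [|u s IHs] A /=; first by rewrite big_nil setU0.
by rewrite IHk IHs big_cons setUA.
Qed.

Lemma foldr_exploreP k (s : seq 'I_n) c S :
  accepts (foldr (explore k) c s (revealed G S)) G =
  accepts (c (revealed G (S :|: \bigcup_(v <- s) ball G k v))) G.
Proof.
elim: s S => [|u s IHs] A /=; first by rewrite big_nil setU0.
by rewrite exploreP IHs big_cons setUA.
Qed.

Lemma foldr_explore_queries d k (s : seq 'I_n) c S q :
  in_model d G -> (forall A, queries (c (revealed G A)) G <= q) ->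
  queries (foldr (explore k) c s (revealed G S)) G <= size s * ball_size d k + q.
Proof.
move=> Gd; elim: k s c S q => [|k IHk] s c S q cq.
  by rewrite muln0; elim: s S => //= u s IHs S.
elim: s S => [|u s IHs] S //=.
rewrite revealedU1 mulSn addSn addSn ltnS.
apply: leq_trans (IHk _ _ _ (size s * ball_size d k.+1 + q) _) _.
  by move=> A; apply: IHs.
by rewrite -addnA leq_add2r leq_mul2r -cardE Gd orbT.
Qed.

End Explore.

(** * Detaching a small set of vertices *)

Lemma pigeonhole_fibre (T C : finType) (f : T -> C) (A : {set T}) :
  0 < #|A| ->
  exists2 v, v \in A & #|A| <= #|[set x in A | f x == f v]| * #|C|.
Proof.
case/card_gt0P => v1 Av1.
pose fibre c := [set x in A | f x == c].
case: (arg_maxnP (fun v => #|fibre (f v)|) Av1) => v Av v_max; exists v => //.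
have A_sub : A \subset \bigcup_(c : C) fibre c.
  by apply/subsetP => x Ax; apply/bigcupP; exists (f x); rewrite ?inE ?Ax ?eqxx.
apply: leq_trans (subset_leq_card A_sub) _; rewrite mulnC.
apply: leq_trans (card_bigcup_le_mul (c := #|fibre (f v)|) _) _; last first.
  by rewrite leq_mul2r max_card orbT.
move=> c _; have [->|/set0Pn[x]] := eqVneq (fibre c) set0; first by rewrite cards0.
by rewrite inE => /andP[Ax /eqP<-]; apply: v_max.
Qed.

Definition copies_meet (H : digraph_set) (T : finType) (G : digraph T)
    (X : {set T}) : Prop :=
  forall m (F : digraph 'I_m) (f : 'I_m -> T),
    H m F -> embedding F G f -> exists x, f x \in X.

Section Extension.
Variables (T : finType) (G : digraph T) (d r c K : nat) (H : digraph_set).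
Variables (h : 'I_K -> T) (X : {set T}).

Let classes := #|{: bool * {set 'I_K}}|.

Hypothesis H_r : is_r_set r H.
Hypothesis G_out : forall v, #|out_nbhd G v| <= d.
Hypothesis G_in :
  forall v, v \notin X -> v \notin codom h -> #|[set u | edge G u v]| <= c.
Hypothesis X_small : 4 * #|X| <= #|T|.
Hypothesis K_small : 4 * K <= #|T|.
Hypothesis T_large : 2 * (classes * (r * (1 + d + c))) < #|T|.
Hypothesis X_meets : copies_meet H G X.

(* The vertices of [X] are detached and turned into copies of a popular vertex
   [v0], keeping only its loop and its edges to the hubs [h]: in a forbidden
   copy they can then be replaced one by one by vertices like [v0] outside [X]. *)
Lemma free_extension :
  exists G' : digraph T,
    [/\ forall v, #|out_nbhd G' v| <= d,
        forall m (F : digraph 'I_m) f, @H m F -> ~ embedding F G' f &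
        forall v, v \notin X -> (forall x, edge G v x -> x \notin X) ->
          out_nbhd G' v = out_nbhd G v].
Proof.
(* [X] and the hubs together fill at most half of [T]. *)
pose A := ~: (X :|: [set x in codom h]).
have A_large : #|T| <= 2 * #|A|.
  have := cardsC (X :|: [set x in codom h]); rewrite -/A => cardA.
  have := leq_card_setU X [set x in codom h] => -[cardU _].
  have card_h : #|[set x in codom h]| <= K.
    by rewrite cardsE -[X in _ <= X]card_ord leq_image_card.
  lia.
(* This is all that the new digraph keeps of [v0]; [classes] counts the possible values. *)
pose f v := (edge G v v, [set k | edge G v (h k)]).
have [|v0 Av0 v0_large] := @pigeonhole_fibre _ _ f A; first by lia.
pose twins := [set x in A | f x == f v0].
have {}v0_large : #|A| <= #|twins| * classes := v0_large.
have like_v0 v : v \in twins ->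
    [/\ v \notin X, v \notin codom h, edge G v v = edge G v0 v0 &
        forall k, edge G v (h k) = edge G v0 (h k)].
  rewrite !inE negb_or => /andP[/andP[vX vh] /eqP[-> /setP fE]].
  by split=> // k; have := fE k; rewrite !inE.
have /like_v0[v0X v0h _ _] : v0 \in twins by rewrite inE Av0 eqxx.
pose G' : digraph T := [set e | if e.1 \in X
  then (e.2 == e.1) && edge G v0 v0
       || [&& e.2 \in codom h, e.2 \notin X & edge G v0 e.2]
  else (e.2 \notin X) && edge G e.1 e.2].
have G'E u v : edge G' u v = if u \in X
  then (v == u) && edge G v0 v0 || [&& v \in codom h, v \notin X & edge G v0 v]
  else (v \notin X) && edge G u v by rewrite /edge /= inE.
exists G'; split=> [v|m F g HF g_emb|v vX v_out].
- case vX: (v \in X); last first.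
    apply: leq_trans (G_out v); apply/subset_leq_card/subsetP => u.
    by rewrite !inE G'E vX => /andP[].
  (* The possible loop at [v] is charged to the loop at [v0]; the other out-neighbours are hubs,
     hence distinct from [v0]. *)
  apply: leq_trans (G_out v0); rewrite (cardsD1 v0 (out_nbhd G v0)).
  apply: leq_trans (_ : #|(if edge G v0 v0 then [set v] else set0)
                          :|: out_nbhd G v0 :\ v0| <= _); last first.
    apply: leq_trans (leq_card_setU _ _) _; rewrite leq_add2r inE.
    by case: ifP; rewrite ?cards1 ?cards0.
  apply/subset_leq_card/subsetP => u; rewrite !inE G'E vX.
  case/orP=> [/andP[/eqP-> ->]|/and3P[uh _ ->]]; first by rewrite inE eqxx.
  by rewrite andbT orbC; case: eqP v0h => // <-; rewrite uh.
- have m_le : m <= r := H_r HF.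
  (* Induction on the number of vertices of the copy that lie in [X]. *)
  have [k] := ubnP #|[set x | g x \in X]|; elim: k g g_emb => // k IHk g.
  move=> [g_inj gE]; rewrite ltnS => gX.
  have [x0 x0X|gX0] := pickP (fun x => g x \in X); last first.
    have [|x] := X_meets HF (f := g); last by rewrite gX0.
    by split=> // x y; rewrite -gE G'E !gX0.
  (* A twin [v] outside every [bad x] is new to the copy, receives no edge from it, and sends none
     to its vertices outside [X] and the hubs. Towards hubs it agrees with [v0], and no edge of [G']
     other than a loop enters [X]. *)
  pose bad x := [set g x] :|: out_nbhd G (g x) :|:
    (if (g x \notin X) && (g x \notin codom h) then [set u | edge G u (g x)]
     else set0).
  have bad_card : #|\bigcup_x bad x| <= r * (1 + d + c).
    apply: leq_trans (card_bigcup_le_mul (c := 1 + d + c) _) _ => [x _|].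
      apply: leq_trans (leq_card_setU _ _) _; apply: leq_add.
        by apply: leq_trans (leq_card_setU _ _) _; rewrite cards1 leq_add2l.
      by case: ifP => [/andP[? ?]|]; rewrite ?cards0 ?G_in.
    by rewrite leq_mul2r (leq_trans _ m_le) ?orbT // -[X in _ <= X]card_ord max_card.
  have [v] : exists v, v \in twins :\: \bigcup_x bad x.
    apply/set0Pn; apply: contraTneq v0_large => /eqP; rewrite setD_eq0.
    move/subset_leq_card => v0_small; rewrite -ltnNge.
    by have := leq_mul (leq_trans v0_small bad_card) (leqnn classes); lia.
  rewrite in_setD => /andP[v_good /like_v0[vX vh v_loop v_hub]].
  have {}v_good x : [/\ v != g x, ~~ edge G (g x) v &
      (g x \notin X) && (g x \notin codom h) -> ~~ edge G v (g x)].
    have : v \notin bad x by apply: contra v_good => ?; apply/bigcupP; exists x.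
    by rewrite !inE !negb_or => /andP[/andP[-> ->]]; case: ifP => //; rewrite inE.
  pose g' x := if x == x0 then v else g x.
  apply: (IHk g').
    split=> [x y|x y]; rewrite /g'.
      case: eqP => [->|_]; case: eqP => [->|_] //; last exact: g_inj.
        by move=> vE; case: (v_good y); rewrite vE eqxx.
      by move=> vE; case: (v_good x); rewrite vE eqxx.
    rewrite -gE !G'E; case: (eqVneq x x0) => [->|xx0]; case: (eqVneq y x0) => [->|yx0].
    + by rewrite (negPf vX) x0X eqxx v_loop /= andbF orbF.
    + rewrite (negPf vX) x0X (inj_eq g_inj) (negPf yx0) /=.
      have [_ _ vgy] := v_good y.
      case yX: (g y \in X) vgy => /=; first by rewrite andbF.
      case yh: (g y \in codom h) => /=; last by move=> /(_ isT)/negPf.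
      by move: yh => /codomP[j ->].
    + rewrite x0X (inj_eq g_inj) [x0 == x]eq_sym (negPf xx0) /= andbF.
      have [vgx /negPf-> _] := v_good x.
      by rewrite andbF (negPf vgx) (negPf vh) /=; case: ifP.
    + by [].
  rewrite (cardsD1 x0) inE x0X in gX; apply: leq_ltn_trans gX.
  apply/subset_leq_card/subsetP => x; rewrite !inE /g'.
  by case: eqP => //=; rewrite (negPf vX).
- apply/setP => x; rewrite !inE G'E (negPf vX).
  by apply: andb_idl => /v_out.
Qed.

End Extension.

(** * Sampling compatible components *)

(** Entries are chosen one after another: each time a fraction at least [1/q] of the choices keeps
    the sequence good, and these fractions multiply. *)
Lemma card_greedy_tuples (T : finType) (good : seq T -> Prop) q :
  (forall s, good s -> #|T| <= q * #|[set u | `[< good (rcons s u) >]]|) ->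
  forall k s, good s ->
  #|T| ^ k <= q ^ k * #|[set t : k.-tuple T | `[< good (s ++ t) >]]|.
Proof.
move=> step; elim=> [|k IHk] s s_good.
  rewrite mul1n; apply/card_gt0P; exists [tuple]; rewrite inE cats0.
  exact/asboolP.
set S := [set _ | _]; have -> : #|S| =
    \sum_u #|[set t : k.-tuple T | `[< good (rcons s u ++ t) >]]|.
  rewrite -sum1_card.
  rewrite (reindex (fun p : T * k.-tuple T => cons_tuple p.1 p.2)) /=; last first.
    exists (fun t => (thead t, behead_tuple t)) => [[u t]|t] _ /=.
      by rewrite theadE; congr pair; apply: val_inj.
    by case/tupleP: t => u t; rewrite theadE; apply: val_inj.
  under [RHS]eq_bigr => u _ do rewrite -sum1_card.
  rewrite pair_big_dep; apply: eq_bigl => [[u t]] /=.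
  by rewrite !inE cat_rcons.
rewrite !expnSr.
apply: leq_trans (leq_mul (leqnn (#|T| ^ k)) (step s s_good)) _.
rewrite mulnCA [q ^ k * q]mulnC -mulnA leq_mul2l; apply/orP; right.
rewrite (bigID (fun u => `[< good (rcons s u) >])) /=.
rewrite mulnDr -[X in X <= _]addn0 leq_add // mulnC -sum_nat_const.
rewrite big_distrr /= [X in X <= _](eq_bigl (fun u => `[< good (rcons s u) >])).
  by apply: leq_sum => u /asboolP/IHk.
by move=> u; rewrite inE.
Qed.

Lemma component_eq (U : finType) (F : digraph U) x y :
  y \in component F x -> component F y = component F x.
Proof.
have sym : connect_sym (underlying F).
  by apply: sym_connect_sym => u v; rewrite /underlying /= orbC.
rewrite inE => xy; apply/setP => z; rewrite !inE.
by rewrite (same_connect sym xy).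
Qed.

Lemma edge_component (U : finType) (F : digraph U) x y :
  edge F x y -> y \in component F x.
Proof. by move=> xy; rewrite inE; apply: connect1; rewrite /underlying /= xy. Qed.

Lemma rooted_root (U : finType) (F : digraph U) :
  rooted F ->
  exists rho : U -> U,
    [/\ forall x, rho x \in component F x,
        forall x y, y \in component F x -> connect (edge F) (rho x) y &
        forall x y, component F x = component F y -> rho x = rho y].
Proof.
move=> F_rooted.
pose is_root (C : {set U}) z := (z \in C) && [forall y in C, connect (edge F) z y].
have root_ex x : exists z, is_root (component F x) z.
  have [z z_root] := F_rooted x; exists (val z).
  rewrite /is_root (valP z); apply/forall_inP => y yx.
  have /connectP[p Fp yE] := z_root (exist _ y yx).
  apply/connectP; exists (map val p); last by rewrite last_map -yE.
  by apply: homo_path Fp => u v; rewrite /edge /= inE.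
(* The [pick] depends on the component alone, so equal components share their root; the default [x]
   is never reached. *)
pose rho x := odflt x [pick z | is_root (component F x) z].
have rhoP x : is_root (component F x) (rho x).
  by rewrite /rho; case: pickP => //= no_root; case: (root_ex x) => z; rewrite no_root.
exists rho; split=> [x|x y|x y xy]; first by case/andP: (rhoP x).
  by case/andP: (rhoP x) => _ /forall_inP; apply.
rewrite /rho xy; case: pickP => //= no_root.
by case: (root_ex y) => z; rewrite no_root.
Qed.

(** The closed in-neighbourhood: detaching [A] alters out-neighbourhoods only here, and a sample
    from here is at most one step away from [A]. *)
Definition in_nbhd (T : finType) (G : digraph T) (A : {set T}) : {set T} :=
  [set u | [exists v in A, (u == v) || edge G u v]].

(* A pattern is a digraph [F] whose vertices [x] with [beta x = Some k] are
   prescribed to be mapped to the hub [h k], and whose other vertices avoid the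
   hubs.  Only the prescribed vertices and the component of [i] have to be
   embedded; the values elsewhere are irrelevant. *)
Definition local_copy (T : finType) (G : digraph T) K (h : 'I_K -> T)
    (M : {set T}) m (F : digraph 'I_m) (beta : {ffun 'I_m -> option 'I_K})
    (i : 'I_m) (psi : 'I_m -> T) : Prop :=
  [/\ forall x k, beta x = Some k -> psi x = h k,
      forall x, x \in component F i -> beta x = None ->
        psi x \notin M /\ psi x \notin codom h &
      forall x y, (x \in component F i) || beta x ->
        (y \in component F i) || beta y ->
        (psi x = psi y -> x = y) /\ edge G (psi x) (psi y) = edge F x y].

Definition centers (T : finType) (G : digraph T) K (h : 'I_K -> T)
    (M : {set T}) m (F : digraph 'I_m) beta (i : 'I_m) : {set T} :=
  [set v | `[< exists2 psi, local_copy G h M F beta i psi & psi i = v >]].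

Section Sampling.
Variables (T : finType) (G : digraph T) (d r c g K : nat).
Variables (h : 'I_K -> T) (M : {set T}).
Variables (m : nat) (F : digraph 'I_m) (beta : {ffun 'I_m -> option 'I_K}).

Hypothesis G_out : forall v, #|out_nbhd G v| <= d.
Hypothesis low : forall v, v \notin M -> v \notin codom h ->
  #|[set u | v \in ball G r.+2 u]| <= c.
Hypotheses (T_gt0 : 0 < #|T|) (g_gt0 : 0 < g) (m_le : m <= r).
Hypothesis F_rooted : rooted F.
Hypothesis centers_large :
  forall i, #|T| <= g * #|in_nbhd G (centers G h M F beta i)|.
Hypothesis c_small : 2 * (g * (r * r * ((1 + d) * c))) <= #|T|.

(** The [i]-th sample serves the component of vertex [i]. It lands near a suitable centre with
    probability at least [1/g], and discarding samples that interfere with earlier copies at most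
    halves this. The copies indexed by the roots are then glued. *)
Lemma card_sample : #|T| ^ r <= (2 * g) ^ r *
  #|[set s : r.-tuple T | `[< exists psi : 'I_m -> T, embedding F G psi /\
       forall x, psi x \in \bigcup_(v <- s) ball G r.+2 v >]]|.
Proof.
have [rho [rho_comp rho_conn rho_eq]] := rooted_root F_rooted.
have comp_rho x : component F (rho x) = component F x := component_eq (rho_comp x).
have rhoK x : rho (rho x) = rho x by apply: rho_eq; apply: comp_rho.
have self_comp x : x \in component F x by rewrite inE connect0.
(* One step leads to the root and fewer than [r] further steps cover its component, whence depth
   [r.+1]; the extra unit in [r.+2] allows for one more edge. *)
pose near v i (psi : 'I_m -> T) := v = psi (rho i) \/ edge G v (psi (rho i)).
have near_ball v i psi x : local_copy G h M F beta (rho i) psi -> near v i psi ->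
    x \in component F i -> psi x \in ball G r.+1 v.
  move=> [_ _ psiE] v_near xi.
  have : psi x \in ball G #|'I_m| (psi (rho i)).
    apply: (@ball_path _ _ F _ _ (component F i)); last exact: rho_conn.
    - move=> u ui w uw; have wi : w \in component F i.
        by rewrite -(component_eq ui) edge_component.
      by split=> //; have [||_ ->] := psiE u w; rewrite ?comp_rho ?ui ?wi.
    - exact: rho_comp.
  rewrite card_ord => psi_x; have {}psi_x := subsetP (subset_ball _ _ m_le) _ psi_x.
  case: v_near => [->|/ball_step]; last exact.
  exact: subsetP (subset_ball _ _ (leqnSn r)) _ psi_x.
pose apart (i j : 'I_m) (psi psi' : 'I_m -> T) :=
  forall x y, x \in component F i -> y \in component F j ->
  beta x = None -> beta y = None -> psi x <> psi' y /\ ~~ edge G (psi x) (psi' y).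
pose good (s : seq T) := exists Psi : 'I_m -> 'I_m -> T,
  (forall i : 'I_m, i < size s -> local_copy G h M F beta (rho i) (Psi i) /\
     exists2 v, v \in s & near v i (Psi i)) /\
  (forall i j : 'I_m, i < size s -> j < size s -> i != j ->
     apart i j (Psi i) (Psi j)).
have good_nil : good [::] by have /card_gt0P[v0 _] := T_gt0; exists (fun _ _ => v0).
have step s : good s -> #|T| <= 2 * g * #|[set u | `[< good (rcons s u) >]]|.
  (* After [m] samples every vertex of [F] is served, and any further sample is good. *)
  move=> [Psi [Psi_copy Psi_apart]]; have [m_le_s|s_lt] := leqP m (size s).
    have lt_s (i : 'I_m) : i < size s := leq_trans (ltn_ord i) m_le_s.
    rewrite -[X in X <= _]mul1n leq_mul ?muln_gt0 //.
    apply/subset_leq_card/subsetP => u _; rewrite inE; apply/asboolP.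
    exists Psi; split=> [i _|i j _ _]; last exact: Psi_apart.
    have [? [v vs v_near]] := Psi_copy i (lt_s i); split=> //.
    by exists v; rewrite ?mem_rcons ?in_cons ?vs ?orbT.
  pose i0 := Ordinal s_lt; pose W := in_nbhd G (centers G h M F beta (rho i0)).
  pose is_low v := (v \notin M) && (v \notin codom h).
  pose reach v := [set u | v \in ball G r.+2 u].
  (* If [u] reaches neither [v] nor a low out-neighbour of [v], a copy seen from [u] neither
     contains [v] nor has an edge between [v] and its non-hub vertices, in either direction. *)
  pose bad v := (if is_low v then reach v else set0)
    :|: \bigcup_(w in out_nbhd G v | is_low w) reach w.
  pose Bad := \bigcup_(p : 'I_m * 'I_m) bad (Psi p.1 p.2).
  have card_reach v : is_low v -> #|reach v| <= c by case/andP=> *; apply: low.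
  have card_Bad : #|Bad| <= r * r * ((1 + d) * c).
    apply: leq_trans (card_bigcup_le_mul (c := (1 + d) * c) _) _ => [p _|].
      apply: leq_trans (leq_card_setU _ _) _; rewrite mulnDl mul1n; apply: leq_add.
        by case: ifP => [/card_reach//|]; rewrite cards0.
      apply: leq_trans (card_bigcup_le_mul (c := c) _) _ => [w /andP[_ /card_reach//]|].
      rewrite leq_mul2r; apply/orP; right; apply: leq_trans (G_out (Psi p.1 p.2)).
      apply: subset_leq_card; apply/subsetP => w.
      by rewrite unfold_in => /andP[].
    by rewrite leq_mul2r card_prod card_ord leq_mul ?orbT.
  have W_large : #|T| <= g * #|W| := centers_large (rho i0).
  apply: leq_trans (_ : 2 * g * #|W :\: Bad| <= _).
    have le_Bad := leq_trans (subset_leq_card (subsetIr W Bad)) card_Bad.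
    have := leq_mul (leqnn g) le_Bad; rewrite cardsD -mulnA mulnBr.
    by move: W_large c_small; lia.
  rewrite leq_mul2l; apply/orP; right.
  apply/subset_leq_card/subsetP => u; rewrite in_setD => /andP[u_good].
  rewrite [u \in W]inE => /exists_inP[v]; rewrite [v \in _]inE => /asboolP[psi psi_copy psi_v] uv.
  have u_near : near u i0 psi by rewrite /near psi_v; case/orP: uv => [/eqP|]; auto.
  have {}u_good i x : u \notin bad (Psi i x).
    by apply: contra u_good => ?; apply/bigcupP; exists (i, x).
  have psi_ball y : y \in component F i0 -> psi y \in ball G r.+1 u.
    exact: near_ball.
  have psi_low y : y \in component F i0 -> beta y = None -> is_low (psi y).
    move=> yi0 beta_y; have [_ psi_out _] := psi_copy.
    by apply/andP; apply: psi_out; rewrite ?comp_rho.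
  have Psi_low (i : 'I_m) x : i < size s -> x \in component F i -> beta x = None ->
      is_low (Psi i x).
    move=> /Psi_copy[[_ Psi_out _] _] xi beta_x.
    by apply/andP; apply: Psi_out; rewrite ?comp_rho.
  have psi_apart (i : 'I_m) : i < size s -> apart i i0 (Psi i) psi /\ apart i0 i psi (Psi i).
    move=> i_lt; split=> x y xi yi beta_x beta_y.
      have := u_good i x; rewrite !inE negb_or Psi_low // inE => /andP[u_far u_out].
      split=> [xy|].
        case/negP: u_far; rewrite xy.
        exact: subsetP (subset_ball _ _ (leqnSn _)) _ (psi_ball y yi).
      apply: contra u_out => xy; apply/bigcupP; exists (psi y).
        by rewrite !inE xy psi_low.
      by rewrite inE; apply: subsetP (subset_ball _ _ (leqnSn _)) _ (psi_ball y yi).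
    have := u_good i y; rewrite !inE negb_or Psi_low // inE => /andP[u_far _].
    split=> [xy|].
      case/negP: u_far; rewrite -xy.
      exact: subsetP (subset_ball _ _ (leqnSn _)) _ (psi_ball x xi).
    by apply: contra u_far; apply: ball_trans; apply: psi_ball.
  have lt_rcons (i : 'I_m) : i < size (rcons s u) -> i <> i0 -> i < size s.
    by rewrite size_rcons ltnS leq_eqVlt => /orP[/eqP i_s []|//]; apply: val_inj.
  rewrite inE; apply/asboolP; exists (fun i => if i == i0 then psi else Psi i).
  split=> [i i_lt|i j i_lt j_lt].
    case: eqP => [->|/(lt_rcons i i_lt)/Psi_copy[? [w ws w_near]]]; split=> //.
      by exists u; rewrite ?mem_rcons ?mem_head.
    by exists w; rewrite ?mem_rcons ?in_cons ?ws ?orbT.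
  case: (i =P i0) => [->|i_neq]; case: (j =P i0) => [->|j_neq]; rewrite ?eqxx // => ij.
  - by have [] := psi_apart j (lt_rcons j j_lt j_neq).
  - by have [] := psi_apart i (lt_rcons i i_lt i_neq).
  - by apply: Psi_apart => //; apply: lt_rcons.
have := card_greedy_tuples step r good_nil.
move/leq_trans; apply; rewrite leq_mul2l; apply/orP; right.
apply/subset_leq_card/subsetP => s; rewrite !inE => /asboolP[Psi [Psi_copy Psi_apart]].
apply/asboolP; rewrite /= size_tuple in Psi_copy Psi_apart.
have lt_r (i : 'I_m) : i < r := leq_trans (ltn_ord i) m_le.
exists (fun x => Psi (rho x) x); split; last first.
  move=> x; have [Psi_x [v vs v_near]] := Psi_copy (rho x) (lt_r _).
  rewrite bigcup_seq; apply/bigcupP; exists v => //.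
  apply: subsetP (subset_ball _ _ (leqnSn _)) _ _.
  by apply: near_ball v_near _; rewrite ?comp_rho // rhoK.
have emb x y : (Psi (rho x) x = Psi (rho y) y -> x = y) /\
    edge G (Psi (rho x) x) (Psi (rho y) y) = edge F x y.
  have copy z : local_copy G h M F beta (rho z) (Psi (rho z)).
    by have [] := Psi_copy (rho z) (lt_r _); rewrite rhoK.
  have in_comp z : z \in component F (rho z) by rewrite comp_rho.
  have [hub_x _ Ex] := copy x; have [hub_y _ Ey] := copy y.
  (* A prescribed vertex has the same image in all local copies, so the pair is compared within the
     copy belonging to the other vertex. *)
  case beta_x: (beta x) => [k|].
    rewrite (hub_x _ _ beta_x) -(hub_y _ _ beta_x).
    by apply: Ey; rewrite ?in_comp ?beta_x ?orbT.
  case beta_y: (beta y) => [k|].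
    rewrite (hub_y _ _ beta_y) -(hub_x _ _ beta_y).
    by apply: Ex; rewrite ?in_comp ?beta_y ?orbT.
  have [xy|xy] := eqVneq (rho x) (rho y).
    by rewrite -xy; apply: Ex; rewrite ?in_comp // xy in_comp.
  have [] := Psi_apart _ _ (lt_r (rho x)) (lt_r (rho y)) xy x y => //.
  move=> neq /negPf->; split=> [/neq //|]; apply/esym/negP => /edge_component Fxy.
  by case/eqP: xy; apply: rho_eq; rewrite (component_eq Fxy).
by split=> [x y|x y]; case: (emb x y).
Qed.

End Sampling.

(** * Choice of the scale and the dichotomy *)

(** A finite type whose cardinality depends on [r] and [K] only, so that the constants are fixed
    before the digraph. *)
Definition pattern r K : finType :=
  {m : 'I_r.+1 & (digraph 'I_m * {ffun 'I_m -> option 'I_K} * 'I_m)%type}.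

Definition pattern_centers (T : finType) (G : digraph T) r K (h : 'I_K -> T)
    (M : {set T}) (p : pattern r K) : {set T} :=
  let: existT m (F, beta, i) := p in centers G h M F beta i.

Lemma sum_card_in_ball (T : finType) (G : digraph T) k :
  \sum_v #|[set u | v \in ball G k u]| = \sum_u #|ball G k u|.
Proof.
under eq_bigr => v _ do rewrite -sum1dep_card.
by rewrite (exchange_big_dep predT) //=; apply: eq_bigr => u _; rewrite sum1_card.
Qed.

(* The ranges [n / a i.+1 <= w v < n / a i] are disjoint, so one of [L] of them
   carries at most the average weight. *)
Lemma light_range (T : finType) (w : T -> nat) (a : nat -> nat) n L :
  {homo a : i j / i <= j} -> 0 < L ->
  exists2 i, i < L &
    L * (\sum_(v | (a i * w v < n) && (n <= a i.+1 * w v)) w v) <= \sum_v w v.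
Proof.
move=> a_mono L_gt0; apply/not_exists2P => no_i.
have: \sum_(i < L) (\sum_v w v).+1 <= \sum_(i < L)
    L * (\sum_(v | (a i * w v < n) && (n <= a i.+1 * w v)) w v).
  by apply: leq_sum => i _; case: (no_i i) => // /negP; rewrite -ltnNge.
rewrite sum_nat_const card_ord -big_distrr leq_mul2l eqn0Ngt L_gt0 /=.
apply/negP; rewrite -leqNgt (exchange_big_dep predT) //=.
apply: leq_sum => v _; rewrite sum_nat_const -[X in _ <= X]mul1n leq_mul2r.
apply/orP; right; apply/card_le1_eqP => i j.
rewrite !unfold_in /= => /andP[ai1 ai2] /andP[aj1 aj2]; apply: val_inj => /=.
have no_lt k l : a k * w v < n -> n <= a l.+1 * w v -> ~~ (l < k).
  move=> ak al; apply/negP => /a_mono lk.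
  by have := leq_trans al (leq_mul lk (leqnn (w v))); rewrite leqNgt ak.
have := no_lt _ _ ai1 aj2; have := no_lt _ _ aj1 ai2; lia.
Qed.

Lemma sample_or_extend (H : digraph_set) (d r E : nat) :
  is_r_set r H -> all_rooted H -> 4 <= E ->
  exists g N, [/\ 0 < g, 0 < N & forall (T : finType) (G : digraph T),
    (forall v, #|out_nbhd G v| <= d) -> N <= #|T| ->
    (exists m (F : digraph 'I_m), H m F /\ #|T| ^ r <= (2 * g) ^ r *
      #|[set s : r.-tuple T | `[< exists psi : 'I_m -> T, embedding F G psi /\
           forall x, psi x \in \bigcup_(v <- s) ball G r.+2 v >]]|) \/
    exists (G' : digraph T) (R : {set T}),
      [/\ forall v, #|out_nbhd G' v| <= d,
          forall m (F : digraph 'I_m) f, H m F -> ~ embedding F G' f,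
          E * #|R| <= #|T| &
          forall v, v \notin R -> out_nbhd G' v = out_nbhd G v]].
Proof.
move=> H_r H_rooted E_ge4.
(* With this many scales, the vertices reaching the lightest range number at most
   [#|T| / (2 * E)]. *)
pose D := ball_size d r.+2; pose L := 2 * E * D.
(* A rare pattern is seen by fewer than [#|T| / gg a] vertices, so all of them together by at most
   [#|T| / (2 * E)]. *)
pose gg a := 2 * E * (#|{: pattern r (a * D)}|).+1.
pose cls a := #|{: bool * {set 'I_(a * D)}}|.
(* The last two summands make [c = #|T| %/ a i.+1] small enough for [card_sample] and
   [free_extension] respectively. *)
pose next a := a + 2 * gg a * (r * r * (1 + d)) + 4 * cls a * r.
pose a i := iter i next 1.
pose bound b := 4 * (b * D) + 4 * cls b * (r * (1 + d)).
have a_gt0 i : 0 < a i by elim: i => //= i IHi; rewrite /next -addnA ltn_addr.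
have a_mono : {homo a : i j / i <= j}.
  by apply: homo_leq => //= [|i]; [exact: leq_trans | rewrite /next -addnA leq_addr].
have L_gt0 : 0 < L by rewrite !muln_gt0 /D /= andbT; lia.
have gg_gt0 b : 0 < gg b by rewrite !muln_gt0; lia.
(* The useful scale depends on the digraph; the sums dominate the constants of every scale. *)
exists (\sum_(i < L) gg (a i)), (\sum_(i < L) bound (a i)).+1; split=> //.
  by rewrite (bigD1 (Ordinal L_gt0)) //= addn_gt0 gg_gt0.
move=> T G G_out T_large.
have T_gt0 : 0 < #|T| by apply: leq_trans T_large.
have [v0 _] : exists v0, v0 \in T by apply/card_gt0P.
pose I v := [set u | v \in ball G r.+2 u].
have sum_I : \sum_v #|I v| <= D * #|T|.
  rewrite sum_card_in_ball mulnC -sum_nat_const.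
  by apply: leq_sum => u _; apply: card_ball.
have [i i_lt light] := @light_range T (fun v => #|I v|) a #|T| L a_mono L_gt0.
set b := a i in light; pose K := b * D; pose g := gg b.
have b_gt0 : 0 < b := a_gt0 i.
pose M := [set v | (b * #|I v| < #|T|) && (#|T| <= a i.+1 * #|I v|)].
pose Z := \bigcup_(v in M) I v.
have Z_small : 2 * E * #|Z| <= #|T|.
  rewrite -(leq_pmul2l (_ : 0 < D)) // mulnA [D * _]mulnC -/L.
  apply: leq_trans sum_I; apply: leq_trans light; rewrite leq_mul2l.
  apply/orP; right; apply: leq_trans (card_bigcup_le _ _) _.
  by rewrite (eq_bigl _ _ (fun v => in_set _ v)).
pose B := [set v | #|T| <= b * #|I v|].
have B_small : #|B| <= K.
  rewrite -(leq_pmul2r T_gt0) -sum_nat_const -mulnA.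
  apply: leq_trans (leq_mul (leqnn b) sum_I).
  rewrite big_distrr /= [X in _ <= X](bigID (mem B)) /= -[X in X <= _]addn0 leq_add //.
  by apply: leq_sum => v; rewrite inE.
pose h (k : 'I_K) := nth v0 (enum B) k.
have hB v : v \in B -> v \in codom h.
  move=> vB; have v_lt : index v (enum B) < K.
    by apply: leq_trans B_small; rewrite cardE index_mem mem_enum.
  by apply/codomP; exists (Ordinal v_lt); rewrite /h /= nth_index ?mem_enum.
pose c := #|T| %/ a i.+1.
have c_le : a i.+1 * c <= #|T| by rewrite mulnC leq_divM.
have low v : v \notin M -> v \notin codom h -> #|I v| <= c.
  move=> vM /(contra (@hB v)); rewrite inE -ltnNge => v_light.
  move: vM; rewrite inE v_light /= -ltnNge leq_divRL // mulnC.
  exact: ltnW.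
pose center_set (p : pattern r K) := pattern_centers G h M p.
pose rare p := g * #|in_nbhd G (center_set p)| < #|T|.
pose X := M :|: \bigcup_(p | rare p) center_set p.
(* [R] contains [X] and every vertex with an edge into [X]. *)
pose R := Z :|: \bigcup_(p | rare p) in_nbhd G (center_set p).
have R_small : E * #|R| <= #|T|.
  have : #|\bigcup_(p | rare p) in_nbhd G (center_set p)|
         <= #|{: pattern r K}| * (#|T| %/ g).
    apply: leq_trans (card_bigcup_le_mul (c := #|T| %/ g) _) _ => [p p_rare|].
      by rewrite leq_divRL ?gg_gt0 // mulnC ltnW.
    by rewrite leq_mul2r max_card orbT.
  move=> rare_small; have g_le : g * (#|T| %/ g) <= #|T| by rewrite mulnC leq_divM.
  have [U_le _] := leq_card_setU Z (\bigcup_(p | rare p) in_nbhd G (center_set p)).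
  have := leq_mul (leqnn (2 * E)) rare_small.
  have : 2 * E * (#|{: pattern r K}| * (#|T| %/ g)) <= g * (#|T| %/ g).
    by rewrite mulnA leq_mul2r leq_mul2l leqnSn !orbT.
  have := leq_mul (leqnn (2 * E)) U_le; rewrite -/R mulnDr.
  move: Z_small g_le; rewrite -!mulnA; lia.
have R_in v x : x \in X -> (v == x) || edge G v x -> v \in R.
  rewrite !inE => /orP[xM|/bigcupP[p p_rare xp]] vx; apply/orP; [left|right].
    apply/bigcupP; exists x; first by rewrite inE.
    rewrite [_ \in I x]in_set.
    case/predU1P: vx => [->|vx]; first exact: ball_self.
    by apply: ball_step vx _; apply: ball_self.
  by apply/bigcupP; exists p => //; rewrite inE; apply/exists_inP; exists x.
have X_small : #|X| <= #|R|.
  by apply/subset_leq_card/subsetP => x xX; apply: (R_in x x); rewrite ?eqxx.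
have bound_le : bound b < #|T|.
  apply: leq_trans T_large; rewrite ltnS (bigD1 (Ordinal i_lt)) //=.
  exact: leq_addr.
have next_le : 2 * g * (r * r * (1 + d)) * c + 4 * cls b * r * c <= #|T|.
  by apply: leq_trans c_le; rewrite -mulnDl leq_mul2r /= /next -addnA leq_addl orbT.
have [X_meets|X_miss] := pselect (copies_meet H G X); [right|left].
  have [||||G' [G'_out G'_free G'_eq]] :=
      @free_extension T G d r c K H h X H_r G_out _ _ _ _ X_meets.
  - move=> v vX vh; apply: leq_trans (low v _ vh); last first.
      by apply: contra vX => vM; rewrite inE vM.
    apply/subset_leq_card/subsetP => u.
    rewrite [u \in I v]in_set in_set => uv.
    by apply: ball_step uv _; apply: ball_self.
  - by apply: leq_trans R_small; apply: leq_mul.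
  - by apply: leq_trans (ltnW bound_le); apply: leq_addr.
  - move: bound_le next_le; rewrite -/(cls b) /bound; lia.
  exists G', R; split=> // v vR; apply: G'_eq => [|x vx].
    by apply: contra vR => vX; apply: R_in vX _; rewrite eqxx.
  by apply: contra vR => xX; apply: R_in xX _; rewrite vx orbT.
move: X_miss => /existsNP[m] /existsNP[F] /existsNP[f] /not_implyP[HF] /not_implyP[f_emb].
move=> /forallNP fX; exists m, F; split=> //.
have m_le : m < r.+1 := H_r _ _ HF.
(* Prescribing the vertices that [f] sends to hubs makes [f] a local copy around each vertex. None
   of these patterns is rare, as its centre would lie in [X]. *)
pose beta := [ffun x => [pick k | h k == f x]].
have g_pow : (2 * g) ^ r <= (2 * \sum_(j < L) gg (a j)) ^ r.
  case: (r) => // k; rewrite leq_exp2r // leq_mul2l /=.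
  by rewrite (bigD1 (Ordinal i_lt)) //= leq_addr.
apply: leq_trans (leq_mul g_pow (leqnn _)).
apply: (@card_sample T G d r c g K h M m F beta) => //.
- exact: gg_gt0.
- exact: H_rooted HF.
- move=> x; rewrite leqNgt; apply/negP => x_rare; apply: (fX x).
  rewrite inE; apply/orP; right; apply/bigcupP.
  exists (existT _ (Ordinal m_le) (F, beta, x)); first exact: x_rare.
  rewrite /center_set /= inE; apply/asboolP; exists f => //.
  have [f_inj fE] := f_emb; split=> [y k|y _|y z _ _]; last 1 first.
  + by split; [exact: f_inj | exact: fE].
  + by rewrite ffunE; case: pickP => // l /eqP<- [->].
  rewrite ffunE; case: pickP => // fh _; split.
    by apply/negP => yM; apply: (fX y); rewrite inE yM.
  by apply/codomP => -[k fk]; have := fh k; rewrite fk eqxx.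
- move: next_le; lia.
Qed.

(** * The tester and its amplification *)

Definition sees_copy (H : digraph_set) n (G : digraph 'I_n) (S : {set 'I_n}) :=
  exists m (F : digraph 'I_m) (psi : 'I_m -> 'I_n),
    [/\ H m F, embedding F G psi & forall x, psi x \in S].

Definition tester (H : digraph_set) n k (s : seq 'I_n) : query_alg n :=
  foldr (explore k) (fun K => Answer n (~~ `[< sees_copy H K.2 K.1 >]))
    s (set0, set0).

Lemma revealed0 n (G : digraph 'I_n) : (set0, set0) = revealed G set0.
Proof. by congr pair; apply/setP => e; rewrite !inE andbF. Qed.

(** Every explored vertex has been queried, so edges and non-edges among explored vertices are known
    exactly. *)
Lemma tester_accepts H n k (s : seq 'I_n) (G : digraph 'I_n) :
  accepts (tester H k s) G = ~~ `[< sees_copy H G (\bigcup_(v <- s) ball G k v) >].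
Proof.
rewrite /tester (revealed0 G) foldr_exploreP set0U /=.
set S := \bigcup_(v <- s) _; congr (~~ _).
apply: asbool_equiv_eq.
have emb m (F : digraph 'I_m) (psi : 'I_m -> 'I_n) : (forall x, psi x \in S) ->
    embedding F (revealed G S).2 psi <-> embedding F G psi.
  move=> psiS; rewrite /embedding.
  have E x y : edge (revealed G S).2 (psi x) (psi y) = edge G (psi x) (psi y).
    by rewrite /edge /= inE /= psiS andbT.
  by split=> -[inj psiE]; split=> // x y; rewrite -psiE E.
by split=> -[m [F [psi [HF psi_emb psiS]]]]; exists m, F, psi; split=> //; apply/emb.
Qed.

Lemma tester_queries H d n k (s : seq 'I_n) (G : digraph 'I_n) :
  in_model d G -> queries (tester H k s) G <= size s * ball_size d k.
Proof.
move=> Gd; rewrite /tester (revealed0 G) -[X in _ <= X]addn0.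
exact: foldr_explore_queries.
Qed.

(** By Bernoulli's inequality [(A + f) ^ q] is at least [f ^ q + q * A * f ^ (q - 1)], and [q * A]
    is at least [f]. *)
Lemma amplification A f q :
  A + f <= q * A -> 0 < q -> 2 * f ^ q <= (A + f) ^ q.
Proof.
case: q => // q Aq _.
have bernoulli k : f ^ k.+1 + k.+1 * A * f ^ k <= (A + f) ^ k.+1.
  elim: k => [|k IHk]; first by rewrite !expn1 muln1 mul1n addnC.
  rewrite [X in _ <= X]expnS; apply: leq_trans (leq_mul (leqnn _) IHk).
  by rewrite !expnS; nia.
apply: leq_trans (bernoulli q); rewrite mulSn mul1n leq_add2l expnS leq_mul2r.
by apply/orP; right; lia.
Qed.

(** * Edit distance *)

Lemma card_edges_from n d (G : digraph 'I_n) (R : {set 'I_n}) :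
  in_model d G -> #|[set e in G | e.1 \in R]| <= d * #|R|.
Proof.
move=> Gd; rewrite mulnC.
apply: leq_trans (card_bigcup_le_mul (P := mem R)
  (A := fun v => [set (v, u) | u in out_nbhd G v]) (c := d) _).
  apply/subset_leq_card/subsetP => -[u v]; rewrite !inE /= => /andP[uv uR].
  by apply/bigcupP; exists u => //; apply: imset_f; rewrite inE.
by move=> v _; apply: leq_trans (leq_imset_card _ _) (Gd v).
Qed.

Lemma dist_le_changed n d (G G' : digraph 'I_n) (R : {set 'I_n}) :
  in_model d G -> in_model d G' ->
  (forall v, v \notin R -> out_nbhd G' v = out_nbhd G v) ->
  dist G G' <= 2 * d * #|R|.
Proof.
move=> Gd G'd eq_out.
have eq_edge u v : u \notin R -> ((u, v) \in G') = ((u, v) \in G).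
  by move/eq_out/setP/(_ v); rewrite !inE.
have diff (G1 G2 : digraph 'I_n) :
    (forall u v, u \notin R -> ((u, v) \in G1) = ((u, v) \in G2)) ->
    in_model d G1 -> #|G1 :\: G2| <= d * #|R|.
  move=> eq12 G1d; apply: leq_trans (card_edges_from R G1d).
  apply/subset_leq_card/subsetP => -[u v]; rewrite !inE /= => /andP[n2 i1].
  by rewrite i1 /=; apply: contraR n2 => uR; rewrite -eq12.
rewrite /dist -mulnA mul2n -addnn leq_add ?diff // => u v uR.
by rewrite eq_edge.
Qed.

Lemma dist_trans n (G1 G2 G3 : digraph 'I_n) :
  dist G1 G3 <= dist G1 G2 + dist G2 G3.
Proof.
have diff (A B C : digraph 'I_n) : #|A :\: C| <= #|A :\: B| + #|B :\: C|.
  apply: leq_trans (leq_card_setU _ _); apply/subset_leq_card/subsetP => e.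
  by rewrite !inE; case: (e \in B); rewrite ?andbT ?orbT // => /andP[-> ->]; rewrite ?orbT.
by have := diff G1 G2 G3; have := diff G3 G2 G1; rewrite /dist; lia.
Qed.

(** * Uniform seeds and the final test *)

Import Order.TTheory GRing.Theory Num.Theory.
Local Open Scope ring_scope.

Section Uniform.
Variables (R : realType) (n : nat) (S : finType) (alg : S -> query_alg n).
Hypothesis S_gt0 : (0 < #|S|)%N.

Lemma uniform_ge0 (s : S) : 0 <= #|S|%:R^-1 :> R.
Proof. by rewrite invr_ge0 ler0n. Qed.

Lemma uniform_sum1 : \sum_(s : S) #|S|%:R^-1 = 1 :> R.
Proof. by rewrite sumr_const -[LHS]mulr_natl; apply: mulfV; rewrite pnatr_eq0 -lt0n. Qed.

Definition uniform_alg : rand_alg R n := RandAlg alg uniform_ge0 uniform_sum1.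

Lemma uniform_accept G :
  (forall s, accepts (alg s) G) -> accept_prob uniform_alg G = 1.
Proof.
move=> all_acc; rewrite /accept_prob /= -[RHS]uniform_sum1.
by apply: eq_bigl => s; rewrite all_acc.
Qed.

Lemma uniform_reject G :
  (2 * #|[set s | accepts (alg s) G]| <= #|S|)%N ->
  2^-1 <= reject_prob uniform_alg G.
Proof.
move=> few_acc; rewrite /reject_prob /= sumr_const -[X in _ <= X]mulr_natl.
rewrite ler_pdivlMr ?ltr0n // mulrC ler_pdivrMr ?ltr0n // -natrM ler_nat.
pose A := [set s | accepts (alg s) G].
have -> : #|(fun s => ~~ accepts (alg s) G)| = #|~: A|.
  by apply: eq_card => s; rewrite !inE unfold_in.
rewrite -(cardsC A) in few_acc *.
by move: few_acc; rewrite -/A; lia.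
Qed.

End Uniform.

Theorem theorem4p5 (R : realType) (d r : nat) (eps : R)
    (eps_gt0 : 0 < eps) (eps_lt1 : eps < 1)
    (H : digraph_set) (H_non_redundant : non_redundant H)
    (H_r_set : is_r_set r H) (H_rooted : all_rooted H)
    (P : digraph_set) (P_property : digraph_property d P)
    (P_sub : forall (n : nat) (G : digraph 'I_n),
       P n G -> induced_free d H n G)
    (P_close : forall n : nat,
       sets_close d (eps / 2) (induced_free d H n) (P n)) :
  one_sided_strongly_testable d eps P.
Proof.
(* From [E * eps >= 4], changing the out-neighbourhoods of [n / E] vertices costs at most
   [2 * d * n / E <= eps / 2 * d * n] edges. *)
pose E := (4 + Num.bound (4 / eps))%N.
have E_eps : 4 <= E%:R * eps.
  rewrite -ler_pdivrMr // natrD.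
  apply: le_trans (ltW (archi_boundP _)) _; first by rewrite divr_ge0 // ltW.
  by rewrite lerDr ler0n.
have [g [N [g_gt0 N_gt0 dichotomy]]] :=
  @sample_or_extend H d r E H_r_set H_rooted (leq_addr _ _).
have no_copy n (G : digraph 'I_n) S : P n G -> ~ sees_copy H G S.
  move=> /P_sub[_ free] [m [F [psi [HF psi_emb _]]]].
  by apply: (free m F HF); apply/has_inducedP; exists psi.
have close_free n (G G' : digraph 'I_n) : induced_free d H n G' ->
    (dist G G')%:R <= eps / 2 * d%:R * n%:R -> close_to_set d eps G (P n).
  move=> G'_free GG'; have [to_P _] := P_close n.
  have [G'' [PG'' G'G'']] := to_P _ G'_free; exists G''; split=> //.
  rewrite /eps_close in G'G'' *; rewrite [eps]splitr !mulrDl.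
  apply: le_trans (lerD GG' G'G''); rewrite -natrD ler_nat.
  exact: dist_trans.
(* At least a fraction [1/Q] of the [r]-tuples reveals a copy, so [Q] independent tuples suffice. *)
pose Q := ((2 * g) ^ r)%N.
have Q_gt0 : (0 < Q)%N by rewrite expn_gt0 muln_gt0 g_gt0.
exists (maxn N (Q * r * ball_size d r.+2)).
have test n : exists A : rand_alg R n, forall G : digraph 'I_n, in_model d G ->
    [/\ P n G -> accept_prob A G = 1,
        ~ close_to_set d eps G (P n) -> 2^-1 <= reject_prob A G &
        forall s, (queries (alg (r := A) s) G <= maxn N (Q * r * ball_size d r.+2))%N].
  have [n_lt|n_ge] := ltnP n N.
    (* For small [n] all vertices are queried deterministically; depth 1 means a single query
       each. *)
    exists (uniform_alg R (fun _ : unit => tester H 1 (enum 'I_n))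
      (eq_leq (esym card_unit))) => G Gd; split=> [PG|far|s].
    - apply: uniform_accept => _; rewrite tester_accepts.
      by apply/negP => /asboolP; apply: no_copy.
    - apply: uniform_reject; rewrite (_ : [set _ | _] = set0) ?cards0 //.
      apply/setP => s; rewrite !inE tester_accepts; apply/negbTE; rewrite negbK.
      apply: contra_notT far => /asboolP no_sight; apply: (close_free n G G).
        split=> // m F HF /has_inducedP[psi psi_emb]; apply: no_sight.
        exists m, F, psi; split=> // x; rewrite bigcup_seq.
        by apply/bigcupP; exists (psi x); rewrite ?mem_enum ?ball_self.
      by rewrite /dist setDv cards0 !mulr_ge0 ?invr_ge0 ?ler0n ?(ltW eps_gt0).
    - apply: leq_trans (tester_queries _ _ _ Gd) _.
      rewrite size_enum_ord /= muln0 muln1; apply: leq_trans (ltnW n_lt) _.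
      exact: leq_maxl.
  pose S := {ffun 'I_Q -> r.-tuple 'I_n}.
  pose starts (f : S) := flatten [seq val (f j) | j <- enum 'I_Q].
  have S_gt0 : (0 < #|S|)%N.
    by rewrite card_ffun card_tuple card_ord !expn_gt0 (leq_trans N_gt0 n_ge).
  exists (uniform_alg R (fun f : S => tester H r.+2 (starts f)) S_gt0).
  move=> G Gd; split=> [PG|far|f].
  - apply: uniform_accept => f; rewrite tester_accepts.
    by apply/negP => /asboolP; apply: no_copy.
  - apply: uniform_reject.
    have [|[m [F [HF many]]]|[G' [X [G'd G'_free X_small G'_eq]]]] :=
      dichotomy _ G Gd; first by rewrite card_ord.
      set found := [set _ | _] in many.
      (* An accepting seed has all its [Q] tuples outside [found]. *)
      apply: leq_trans (_ : 2 * #|~: found| ^ Q <= _)%N.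
        rewrite leq_mul2l /=.
        have -> : (#|~: found| ^ Q)%N = #|@ffun_on 'I_Q (~: found)|.
          by rewrite card_ffun_on card_ord.
        apply/subset_leq_card/subsetP => f; rewrite inE tester_accepts => f_acc.
        apply/ffun_onP => j; rewrite !inE; apply: contra f_acc.
        move=> /asboolP[psi [psi_emb psi_in]]; apply/asboolP; exists m, F, psi.
        split=> // x; have := psi_in x; rewrite !bigcup_seq => /bigcupP[v vf xv].
        apply/bigcupP; exists v => //; apply/flattenP; exists (tval (f j)) => //.
        by apply/mapP; exists j; rewrite ?mem_enum.
      have := cardsC found; rewrite card_tuple => found_compl.
      rewrite card_ffun card_tuple [#|'I_Q|]card_ord -found_compl.
      by apply: amplification; rewrite // found_compl.
    case: far; apply: (close_free n G G').
      split=> // m F HF /has_inducedP[psi]; exact: G'_free.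
    apply: le_trans (_ : (2 * d * #|X|)%:R <= _).
      by rewrite ler_nat; apply: dist_le_changed.
    rewrite card_ord in X_small.
    have {}X_small : E%:R * #|X|%:R <= n%:R :> R by rewrite -natrM ler_nat.
    have d_ge0 : 0 <= d%:R :> R := ler0n _ _.
    have X_ge0 : 0 <= #|X|%:R :> R := ler0n _ _.
    rewrite !natrM; move: X_small E_eps d_ge0 X_ge0 eps_gt0.
    move: #|X|%:R E%:R n%:R d%:R => x e y D EX Ee D0 x0 eps0.
    have y_ge : 4 * x <= eps * y.
      apply: le_trans (_ : e * eps * x <= _); first exact: ler_wpM2r.
      by rewrite [e * eps]mulrC -mulrA ler_wpM2l // ltW.
    have := ler_wpM2l D0 y_ge; lra.
  - apply: leq_trans (tester_queries _ _ _ Gd) _; apply: leq_trans (leq_maxr _ _).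
    rewrite leq_mul2r; apply/orP; right; rewrite size_flatten /shape -map_comp.
    rewrite sumnE big_map (eq_bigr (fun=> r)) => [|j _]; last exact: size_tuple.
    by rewrite big_const_seq count_predT size_enum_ord iter_addn_0 mulnC.
exists (fun n => sval (cid (test n))); split=> [n G Gd|n G Gd s].
  by have [? ? _] := svalP (cid (test n)) G Gd.
by have [_ _] := svalP (cid (test n)) G Gd; apply.
Qed.
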